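(* For every integer $n\ge 3$, the helm graph $H_n$ satisfies $$\alpha(H_n)+\alpha(L(H_n))=2n+1 \quad\text{and}\quad \alpha(H_n)\cdot\alpha(L(H_n))=n(n+1).$$
   Context: For $n\ge 3$, the wheel graph $W_{n+1}$ is the graph $K_1+C_n$ (the join of a single vertex with the cycle $C_n$ on $n$ vertices). The helm graph $H_n$ is the graph obtained from the wheel $W_{n+1}$ by attaching one pendant edge to each of the $n$ vertices of the cycle $C_n$. For a graph $G$, $\alpha(G)$ denotes its independence number, i.e. the maximum cardinality of a set of pairwise non-adjacent vertices of $G$. $L(G)$ denotes the line graph of $G$: its vertices are in one-to-one correspondence with the edges of $G$, and two vertices of $L(G)$ are adjacent if and only if the corresponding edges of $G$ are adjacent (share an endpoint). *)

(* Defs.v *)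
From HB Require Import structures.
From mathcomp Require Import all_boot.

Set Implicit Arguments.
Unset Strict Implicit.
Unset Printing Implicit Defensive.

Record sgraph := SGraph {
  vertex :> finType;
  adj : rel vertex;
  adj_sym : symmetric adj;
  adj_irr : irreflexive adj }.

Definition independent (G : sgraph) (S : {set G}) : bool :=
  [forall x in S, forall y in S, ~~ adj x y].

Definition independence_number (G : sgraph) : nat :=
  \max_(S : {set G} | independent S) #|S|.

Definition edges (G : sgraph) : {set {set G}} :=
  [set e : {set G} | [exists x, exists y, adj x y && (e == [set x; y])]].

Section LineGraph.
Variable G : sgraph.

Definition edge_type : finType := {e : {set G} | e \in edges G}.

Definition line_adj : rel edge_type :=
  fun e f => (e != f) && (val e :&: val f != set0).

Lemma line_adj_sym : symmetric line_adj.
Proof. by move=> e f; rewrite /line_adj eq_sym setIC. Qed.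

Lemma line_adj_irr : irreflexive line_adj.
Proof. by move=> e; rewrite /line_adj eqxx. Qed.

Definition line_graph : sgraph := SGraph line_adj_sym line_adj_irr.
End LineGraph.

Section Complete.
Variable n : nat.

Definition complete_adj : rel 'I_n := fun i j => i != j.

Lemma complete_adj_sym : symmetric complete_adj.
Proof. by move=> i j; rewrite /complete_adj eq_sym. Qed.

Lemma complete_adj_irr : irreflexive complete_adj.
Proof. by move=> i; rewrite /complete_adj eqxx. Qed.

Definition complete_graph : sgraph := SGraph complete_adj_sym complete_adj_irr.
End Complete.

(* [ordS] is the successor modulo [n]; the result is a cycle only for
   [3 <= n], and [i != j] excludes the loop that would appear at [n = 1]. *)
Section Cycle.
Variable n : nat.

Definition cycle_adj : rel 'I_n :=
  fun i j => (i != j) && ((j == ordS i) || (i == ordS j)).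

Lemma cycle_adj_sym : symmetric cycle_adj.
Proof. by move=> i j; rewrite /cycle_adj eq_sym orbC. Qed.

Lemma cycle_adj_irr : irreflexive cycle_adj.
Proof. by move=> i; rewrite /cycle_adj eqxx. Qed.

Definition cycle_graph : sgraph := SGraph cycle_adj_sym cycle_adj_irr.
End Cycle.

Section Join.
Variables G H : sgraph.

Definition join_adj : rel (G + H)%type := fun u v =>
  match u, v with
  | inl x, inl y => adj x y
  | inr x, inr y => adj x y
  | _, _ => true
  end.

Lemma join_adj_sym : symmetric join_adj.
Proof. by move=> [x|x] [y|y] //=; apply: adj_sym. Qed.

Lemma join_adj_irr : irreflexive join_adj.
Proof. by move=> [x|x] /=; apply: adj_irr. Qed.

Definition graph_join : sgraph := SGraph join_adj_sym join_adj_irr.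
End Join.

(* One new vertex [inr i] for each [i : I], joined only to [inl (f i)]. *)
Section Pendants.
Variables (G : sgraph) (I : finType) (f : I -> G).

Definition pendant_adj : rel (G + I)%type := fun u v =>
  match u, v with
  | inl x, inl y => adj x y
  | inl x, inr i | inr i, inl x => x == f i
  | inr _, inr _ => false
  end.

Lemma pendant_adj_sym : symmetric pendant_adj.
Proof. by move=> [x|i] [y|j] //=; apply: adj_sym. Qed.

Lemma pendant_adj_irr : irreflexive pendant_adj.
Proof. by move=> [x|i] //=; apply: adj_irr. Qed.

Definition attach_pendants : sgraph := SGraph pendant_adj_sym pendant_adj_irr.
End Pendants.

(* [wheel_graph n] is the wheel on [n.+1] vertices, written W_(n+1). *)
Definition wheel_graph (n : nat) : sgraph :=
  graph_join (complete_graph 1) (cycle_graph n).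

Definition rim (n : nat) (i : 'I_n) : wheel_graph n := inr i.

Definition helm_graph (n : nat) : sgraph := attach_pendants (@rim n).

(* Main.v *)
(* Each [rim i] is adjacent to the pendant [inr i], so the hub together with
   these [n] pairs covers [H_n] by [n + 1] cliques, and hub plus pendants form
   an independent set meeting each of them. Every edge of [H_n] has an endpoint
   on the rim, so a matching has at most [n] edges, and the pendant edges
   attain this bound. *)
Require Import Defs.
From mathcomp Require Import all_boot.

Set Implicit Arguments.
Unset Strict Implicit.
Unset Printing Implicit Defensive.

(* The fibres of [f] form a cover of [G] by cliques. *)
Lemma independence_number_le (G : sgraph) (T : finType) (f : G -> T) :
    (forall x y, x != y -> f x = f y -> adj x y) ->
  independence_number G <= #|T|.
Proof.
move=> f_clique; apply/bigmax_leqP => S /forall_inP S_indep.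
rewrite -(@card_in_imset _ _ f) ?max_card // => x y xS yS fxy.
apply/eqP; apply: contraT => neq_xy.
by have /forall_inP/(_ y yS) := S_indep x xS; rewrite f_clique.
Qed.

Lemma independence_number_ge (G : sgraph) (T : finType) (f : T -> G) :
    injective f -> (forall a b, ~~ adj (f a) (f b)) ->
  #|T| <= independence_number G.
Proof.
move=> f_inj f_indep; rewrite -(card_imset predT f_inj).
apply: leq_bigmax_cond; apply/forall_inP => _ /imsetP[a _ ->].
by apply/forall_inP => _ /imsetP[b _ ->].
Qed.

Lemma independence_number_helm n : independence_number (helm_graph n) = n.+1.
Proof.
(* [option 'I_n] has [n.+1] elements and indexes the covering cliques: [None] for the hub, [Some i]
   for [rim i] with its pendant. *)
rewrite -[in RHS](card_ord n) -card_option.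
apply/eqP; rewrite eqn_leq; apply/andP; split.
  pose f (v : helm_graph n) : option 'I_n :=
    match v with
    | inl (inl _) => None
    | inl (inr i) | inr i => Some i
    end.
  apply: (@independence_number_le _ _ f).
  by move=> [[h|i]|i] [[k|j]|j] //= neq_xy [eq_ij]; rewrite eq_ij eqxx in neq_xy *.
(* [ord0] is the only vertex of [complete_graph 1], so [None] is sent to the hub. *)
pose g (o : option 'I_n) : helm_graph n :=
  if o is Some i then inr i else inl (inl ord0).
by apply: (@independence_number_ge _ _ g) => [[i|] [j|] // [->]|[i|] [j|]].
Qed.

(** The hub carries no loop and a pendant is adjacent only to its rim vertex, so hub and pendants
    span no edge. *)
Lemma helm_edge_meets_rim n (e : edge_type (helm_graph n)) :
  exists i, (inl (rim i) : helm_graph n) \in val e.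
Proof.
case: e => e /=; rewrite inE => /existsP[x /existsP[y /andP[adj_xy /eqP->]]].
case: x y adj_xy => [[h|i]|i] [[k|j]|j] //=.
- by rewrite (ord1 h) (ord1 k) /complete_adj eqxx.
- by exists j; rewrite !inE eqxx orbT.
- by exists i; rewrite !inE eqxx.
- by exists i; rewrite !inE eqxx.
- by exists i; rewrite !inE eqxx.
- by exists j; rewrite !inE eqxx orbT.
Qed.

Lemma pendant_edge_subproof n (i : 'I_n) :
  [set inl (rim i); inr i] \in edges (helm_graph n).
Proof.
rewrite inE; apply/existsP; exists (inl (rim i)); apply/existsP; exists (inr i).
by rewrite /= !eqxx.
Qed.

Definition pendant_edge n (i : 'I_n) : edge_type (helm_graph n) :=
  exist (fun e => e \in edges (helm_graph n)) _ (pendant_edge_subproof i).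

(** Serves twice: for the injectivity of [pendant_edge] and for the independence of its image in the
    line graph. *)
Lemma pendant_edge_meet n (i j : 'I_n) :
  val (pendant_edge i) :&: val (pendant_edge j) != set0 -> i = j.
Proof.
case/set0Pn=> x; rewrite !inE => /andP[].
by case/orP=> /eqP-> /orP[] /eqP // [].
Qed.

Lemma independence_number_line_helm n :
  independence_number (line_graph (helm_graph n)) = n.
Proof.
rewrite -[RHS]card_ord; apply/eqP; rewrite eqn_leq; apply/andP; split.
  (* Each edge is labelled by a chosen rim endpoint; distinct edges with the same label share that
     endpoint, hence are adjacent in the line graph. *)
  pose f e := xchoose (@helm_edge_meets_rim n e).
  have f_in e : (inl (rim (f e)) : helm_graph n) \in val e.
    exact: (xchooseP (helm_edge_meets_rim e)).
  apply: (@independence_number_le (line_graph _) _ f) => x y neq_xy fxy.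
  rewrite /= /line_adj neq_xy; apply/set0Pn; exists (inl (rim (f x))).
  by rewrite inE f_in fxy f_in.
apply: (@independence_number_ge (line_graph (helm_graph n)) _ (@pendant_edge n)).
  (* A nonempty edge meets itself, so equal pendant edges have equal indices. *)
  move=> i j eq_ij; apply: pendant_edge_meet; rewrite -eq_ij setIid.
  by apply/set0Pn; exists (inr i); rewrite !inE eqxx orbT.
by move=> i j; apply/negP => /andP[/negP neq_ij /pendant_edge_meet eq_ij];
  apply: neq_ij; rewrite eq_ij.
Qed.

Theorem theorem2p8 (n : nat) (hn : 3 <= n) :
  independence_number (helm_graph n)
    + independence_number (line_graph (helm_graph n)) = 2 * n + 1
  /\ independence_number (helm_graph n)
    * independence_number (line_graph (helm_graph n)) = n * (n + 1).
Proof.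
rewrite independence_number_helm independence_number_line_helm.
by rewrite addSn addnn mul2n !addn1 mulnC.
Qed.
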